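(* Let $w_1=1$, $w_i=0$ for $i=2,3,\ldots,p$, and $\lambda=1$. Then every GOWA robust optimal solution to $\mathcal{P}(\Omega)$ (for these $w$ and $\lambda$) is a min-max robust optimal solution to $\mathcal{P}(\Omega)$, and vice versa.
   Context: Setting: $\Omega=\{\zeta_1,\ldots,\zeta_p\}\subseteq\mathbb{R}^m$ is a finite (ordered) uncertainty set, $\mathcal{X}\subseteq\mathbb{R}^n$ is a compact feasible set independent of $\Omega$, and $f:\mathcal{X}\times\Omega\to\mathbb{R}$ satisfies $f(x,\zeta)\ge 0$ for all $x\in\mathcal{X}$, $\zeta\in\Omega$. The uncertain single objective optimization problem $\mathcal{P}(\Omega)$ is the family of problems $\min_{x\in\mathcal{X}} f(x,\zeta)$, $\zeta\in\Omega$. Auxiliary functions $s_1,\ldots,s_p:\mathcal{X}\to\mathbb{R}$: for each $x$, recursively for $i=1,\ldots,p$, let $j_i(x)$ be the smallest index among those $j\in\{1,\ldots,p\}\setminus\{j_1(x),\ldots,j_{i-1}(x)\}$ at which $f(x,\zeta_j)$ is maximal over that remaining index set, and put $s_i(x)=f(x,\zeta_{j_i(x)})$. Thus exactly one index is removed at each step, so $s_i(x)$ is the $i$-th largest of the values $f(x,\zeta_1),\ldots,f(x,\zeta_p)$ counted with multiplicity. For a real $\lambda>0$ and weights $w_i\ge0$ with $\sum_{i=1}^p w_i=1$, the GOWA robust objective function is $\phi(x)=\left(\sum_{i=1}^{p}w_i(s_i(x))^{\lambda}\right)^{1/\lambda}$, $x\in\mathcal{X}$. A point $\bar x\in\mathcal{X}$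 is a GOWA robust optimal solution to $\mathcal{P}(\Omega)$ if it minimizes $\phi$ over $\mathcal{X}$; it is a min-max robust optimal solution to $\mathcal{P}(\Omega)$ if it minimizes $x\mapsto\max_{\zeta\in\Omega}f(x,\zeta)$ over $\mathcal{X}$. *)

(* Defs.v *)
From HB Require Import structures.
From mathcomp Require Import all_boot all_order all_algebra.
From mathcomp Require Import all_classical all_reals all_analysis.

Set Implicit Arguments.
Unset Strict Implicit.
Unset Printing Implicit Defensive.
Import Order.TTheory GRing.Theory Num.Theory.
Import numFieldNormedType.Exports.
Local Open Scope classical_set_scope.
Local Open Scope ring_scope.

(* The uncertainty set is given by its enumeration [zeta : 'I_p.+1 -> 'rV_m];
   indices start at 0, so [ord0] is the index written 1 on paper. *)

(* [j] is the smallest index at which [a] is maximal over the complement of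
   [used]. *)
Definition is_next (R : realType) (p : nat) (a : 'I_p.+1 -> R)
    (used : seq 'I_p.+1) (j : 'I_p.+1) : bool :=
  let is_argmax k :=
    (k \notin used) && [forall l, (l \notin used) ==> (a l <= a k)] in
  is_argmax j && [forall k, is_argmax k ==> (j <= k)%N].

(* The default [ord0] is reached only when [used] contains every index. *)
Definition next_index (R : realType) (p : nat) (a : 'I_p.+1 -> R)
    (used : seq 'I_p.+1) : 'I_p.+1 :=
  odflt ord0 [pick j | is_next a used j].

(* The first [i] indices selected, in order of selection. *)
Fixpoint selected (R : realType) (p : nat) (a : 'I_p.+1 -> R) (i : nat)
    : seq 'I_p.+1 :=
  if i is i'.+1 then
    rcons (selected a i') (next_index a (selected a i'))
  else [::].

Definition sel_index (R : realType) (p : nat) (a : 'I_p.+1 -> R)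
    (i : 'I_p.+1) : 'I_p.+1 :=
  next_index a (selected a i).

Section Problem.
Variables (R : realType) (n m p : nat).
Variables (f : 'rV[R]_n -> 'rV[R]_m -> R) (zeta : 'I_p.+1 -> 'rV[R]_m).

Definition sorted_value (i : 'I_p.+1) (x : 'rV[R]_n) : R :=
  f x (zeta (sel_index (fun j => f x (zeta j)) i)).

Definition gowa_objective (lambda : R) (w : 'I_p.+1 -> R) (x : 'rV[R]_n) : R :=
  (\sum_(i < p.+1) w i * sorted_value i x `^ lambda) `^ (1 / lambda).

(* The base element of the iterated maximum is itself one of the values. *)
Definition worst_case (x : 'rV[R]_n) : R :=
  \big[Num.max/f x (zeta ord0)]_(j < p.+1) f x (zeta j).

Definition minimizes (X : set 'rV[R]_n) (g : 'rV[R]_n -> R) (x : 'rV[R]_n)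
    : Prop :=
  X x /\ forall y, X y -> g x <= g y.

Definition gowa_robust_optimal (X : set 'rV[R]_n) (lambda : R)
    (w : 'I_p.+1 -> R) (x : 'rV[R]_n) : Prop :=
  minimizes X (gowa_objective lambda w) x.

Definition minmax_robust_optimal (X : set 'rV[R]_n) (x : 'rV[R]_n) : Prop :=
  minimizes X worst_case x.

End Problem.

(* Main.v *)
Require Import Defs.
From HB Require Import structures.
From mathcomp Require Import all_boot all_order all_algebra.
From mathcomp Require Import all_classical all_reals all_analysis.

Set Implicit Arguments.
Unset Strict Implicit.
Unset Printing Implicit Defensive.
Import Order.TTheory GRing.Theory Num.Theory.
Import numFieldNormedType.Exports.
Local Open Scope classical_set_scope.
Local Open Scope ring_scope.

(** With all the weight on the first index and [lambda = 1], the GOWA objective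
    collapses to the first sorted value, because on nonnegative reals the powers
    of exponent [1] and [1 / 1] are the identity. The first selection step runs
    over all indices and picks one where the value is maximal, so the first
    sorted value is the worst case ([sorted_value_ord0]). The two objectives thus
    agree on the feasible set ([gowa_objective_first]), and functions that agree
    on a set have the same minimizers there. *)

(** The selection rule never falls back on its default index while some index is
    unused: the maximum of [a] over the unused indices is attained, and among the
    indices attaining it one is smallest. *)
Lemma next_indexP (R : realType) (p : nat) (a : 'I_p.+1 -> R)
    (used : seq 'I_p.+1) (j0 : 'I_p.+1) :
  j0 \notin used -> is_next a used (next_index a used).
Proof.
move=> j0_free; rewrite /next_index; case: pickP => //= no_next.
pose is_argmax k :=
  (k \notin used) && [forall l, (l \notin used) ==> (a l <= a k)].
have [k k_argmax] : exists k, is_argmax k.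
  case: (@arg_maxP _ _ _ j0 [pred l | l \notin used] a j0_free) => k k_free k_max.
  exists k; rewrite /is_argmax; apply/andP; split=> //.
  by apply/forallP => l; apply/implyP => /k_max.
case: (@arg_minnP _ k is_argmax (@nat_of_ord _) k_argmax) => j j_argmax j_min.
have /negP[] := negbT (no_next j); rewrite /is_next; apply/andP; split=> //.
by apply/forallP => l; apply/implyP => /j_min.
Qed.

Lemma le_next_index (R : realType) (p : nat) (a : 'I_p.+1 -> R)
    (used : seq 'I_p.+1) (l : 'I_p.+1) :
  l \notin used -> a l <= a (next_index a used).
Proof.
move=> l_free; have /andP[/andP[_ /forallP/(_ l)]] := next_indexP a l_free.
by rewrite l_free.
Qed.

Lemma sorted_value_ord0 (R : realType) (n m p : nat)
    (f : 'rV[R]_n -> 'rV[R]_m -> R) (zeta : 'I_p.+1 -> 'rV[R]_m)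
    (x : 'rV[R]_n) :
  sorted_value f zeta ord0 x = worst_case f zeta x.
Proof.
have max_first l : f x (zeta l) <= sorted_value f zeta ord0 x.
  exact: (@le_next_index _ _ (fun j => f x (zeta j)) [::]).
apply/eqP; rewrite eq_le; apply/andP; split; first exact: le_bigmax.
by apply: bigmax_le => [|l _]; exact: max_first.
Qed.

(** Nonnegativity is what makes the real power of exponent [1] the identity:
    on negative reals, [powR] is not the usual power. *)
Lemma gowa_objective_first (R : realType) (n m p : nat)
    (f : 'rV[R]_n -> 'rV[R]_m -> R) (zeta : 'I_p.+1 -> 'rV[R]_m)
    (w : 'I_p.+1 -> R) (x : 'rV[R]_n) :
  (forall j, 0 <= f x (zeta j)) -> w ord0 = 1 ->
  (forall i, i != ord0 -> w i = 0) ->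
  gowa_objective f zeta 1 w x = worst_case f zeta x.
Proof.
move=> f_ge0 w_first w_other.
rewrite /gowa_objective (bigD1 ord0) //= big1 => [|i /w_other ->].
  have s_ge0 : 0 <= sorted_value f zeta ord0 x by exact: f_ge0.
  by rewrite addr0 w_first mul1r divr1 !powRr1 // sorted_value_ord0.
by rewrite mul0r.
Qed.

Lemma eq_in_minimizes (R : realType) (n : nat) (X : set 'rV[R]_n)
    (g h : 'rV[R]_n -> R) (x : 'rV[R]_n) :
  (forall y, X y -> g y = h y) -> minimizes X g x <-> minimizes X h x.
Proof.
move=> gh; split=> -[Xx x_min]; split=> // y Xy; have := x_min y Xy;
  by rewrite !gh.
Qed.

Theorem proposition4p1 (R : realType) (n m p : nat)
  (zeta : 'I_p.+1 -> 'rV[R]_m) (zeta_inj : injective zeta)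
  (X : set 'rV[R]_n) (X_compact : compact X)
  (f : 'rV[R]_n -> 'rV[R]_m -> R)
  (f_ge0 : forall x, X x -> forall j, 0 <= f x (zeta j))
  (w : 'I_p.+1 -> R) (w_first : w ord0 = 1)
  (w_other : forall i, i != ord0 -> w i = 0) :
  forall xbar : 'rV[R]_n,
    gowa_robust_optimal f zeta X 1 w xbar <->
    minmax_robust_optimal f zeta X xbar.
Proof.
move=> xbar; apply: eq_in_minimizes => y Xy.
by apply: gowa_objective_first => //; exact: f_ge0.
Qed.
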